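(* Let $\mathbb K$ be a non-Archimedean valued field with nontrivial valuation, let $X$ be a separable Banach space over $\mathbb K$ and let $T:X\to X$ be a continuous linear operator. If $T$ satisfies the Supercyclic Criterion, then $T$ is supercyclic.
   Context: A non-Archimedean valued field is a commutative field $\mathbb K$ with a map $|\cdot|:\mathbb K\to[0,+\infty)$ such that $|\lambda|=0$ iff $\lambda=0$, $|\lambda\mu|=|\lambda||\mu|$, and $|\lambda+\mu|\le\max\{|\lambda|,|\mu|\}$; the valuation is always assumed nontrivial. A normed space over $\mathbb K$ is a $\mathbb K$-vector space $X$ with a map $\|\cdot\|:X\to[0,+\infty)$ such that $\|\mathbf x\|=0$ iff $\mathbf x=\mathbf 0$, $\|\lambda\mathbf x\|=|\lambda|\|\mathbf x\|$, and $\|\mathbf x+\mathbf y\|\le\max\{\|\mathbf x\|,\|\mathbf y\|\}$; it is a Banach space if it is complete for the metric $\|\mathbf x-\mathbf y\|$. A continuous linear operator $T$ on $X$ is supercyclic if there exists $\mathbf x\in X$ whose projective orbit $\{\lambda T^n(\mathbf x): n\in\mathbb Z,\ n\ge 0,\ \lambda\in\mathbb K\}$ is dense in $X$. $T$ satisfies the Supercyclic Criterion if there exist a (strictly) increasing sequence of nonnegative integers $(n_k)$, two dense sets $\mathcal D_1,\mathcal D_2\subset X$ and a sequence of maps $S_{n_k}:\mathcal D_2\to X$ (not assumed linear or continuous) such that, as $k\to\infty$: (1) $\|T^{n_k}(\mathbf x)\|\,\|S_{n_k}(\mathbf y)\|\to 0$ for any $\mathbf x\in\mathcal D_1$ and any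 $\mathbf y\in\mathcal D_2$; (2) $T^{n_k}S_{n_k}(\mathbf y)\to\mathbf y$ for any $\mathbf y\in\mathcal D_2$. *)

(* Defs.v *)
From HB Require Import structures.
From mathcomp Require Import all_boot all_order all_algebra.
From mathcomp Require Import all_classical all_reals all_analysis.

Set Implicit Arguments.
Unset Strict Implicit.
Unset Printing Implicit Defensive.

Import Order.TTheory GRing.Theory Num.Theory.
Import numFieldNormedType.Exports.

Local Open Scope classical_set_scope.
Local Open Scope ring_scope.

(* MathComp's normed modules have scalars in a [numFieldType], whose absolute
   value takes its values in the scalar field itself, and their norm satisfies
   [`|x *+ n| = `|x| *+ n]. Neither fits a non-Archimedean valuation on an
   arbitrary field, with values in an unrelated field of real numbers. *)
HB.mixin Record Field_isNAValued (R : realType) K of GRing.Field K := {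
  naval : K -> R ;
  naval_ge0 : forall a, 0 <= naval a ;
  naval_eq0 : forall a, naval a = 0 <-> a = 0 ;
  navalM : forall a b, naval (a * b) = naval a * naval b ;
  navalD : forall a b, naval (a + b) <= Num.max (naval a) (naval b) ;
}.

#[short(type="naValuedFieldType")]
HB.structure Definition NAValuedField (R : realType) :=
  {K of GRing.Field K & Field_isNAValued R K}.

Definition nontrivial_valuation (R : realType) (K : naValuedFieldType R) :=
  exists a : K, a != 0 /\ naval a != 1.

HB.mixin Record Lmodule_isNANormed (R : realType)
    (K : naValuedFieldType R) X of GRing.Lmodule K X := {
  nanorm : X -> R ;
  nanorm_ge0 : forall x, 0 <= nanorm x ;
  nanorm_eq0 : forall x, nanorm x = 0 <-> x = 0 ;
  nanormZ : forall (a : K) x, nanorm (a *: x) = naval a * nanorm x ;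
  nanormD : forall x y, nanorm (x + y) <= Num.max (nanorm x) (nanorm y) ;
}.

#[short(type="naNormedModType")]
HB.structure Definition NANormedModule (R : realType)
    (K : naValuedFieldType R) :=
  {X of GRing.Lmodule K X & Lmodule_isNANormed R K X}.

Section NormMetric.
Context (R : realType) (K : naValuedFieldType R) (X : naNormedModType K).
Implicit Types x y z : X.

Definition nadist x y : R := nanorm (x - y).

Lemma naval1 : naval (1 : K) = 1.
Proof.
have n0 : naval (1 : K) != 0.
  by apply/eqP => /naval_eq0/eqP; rewrite oner_eq0.
by apply: (mulfI n0); rewrite -navalM !mulr1.
Qed.

Lemma navalN1 : naval (- 1 : K) = 1.
Proof.
apply/eqP; rewrite -(@eqrXn2 _ 2) ?naval_ge0 //.
by rewrite expr2 -navalM mulrNN mulr1 naval1 expr1n.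
Qed.

Lemma nanormN x : nanorm (- x) = nanorm x.
Proof. by rewrite -scaleN1r nanormZ navalN1 mul1r. Qed.

Lemma nadistxx x : nadist x x = 0.
Proof. by apply/nanorm_eq0; rewrite subrr. Qed.

Lemma nadist_eq0 x y : nadist x y = 0 -> x = y.
Proof. by move=> /nanorm_eq0/eqP; rewrite subr_eq0 => /eqP. Qed.

Lemma nadist_sym x y : nadist x y = nadist y x.
Proof. by rewrite /nadist -nanormN opprB. Qed.

Lemma nadist_triangle y x z : nadist x z <= nadist x y + nadist y z.
Proof.
rewrite /nadist -{1}[x](subrK y) -addrA; apply: (le_trans (nanormD _ _)).
by rewrite ge_max lerDl lerDr !nanorm_ge0.
Qed.

HB.instance Definition _ := isMetric.Build R (NANormedModule.sort X)
  nadistxx nadist_eq0 nadist_sym nadist_triangle.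

End NormMetric.

Definition complete_space (X : uniformType) :=
  forall F : set_system X, ProperFilter F -> cauchy F -> exists x : X, F --> x.

Definition separable_space (X : topologicalType) :=
  exists A : set X, countable A /\ dense A.

Section Supercyclicity.
Context (R : realType) (K : naValuedFieldType R) (X : naNormedModType K).

Definition projective_orbit (T : X -> X) (x : X) : set X :=
  [set y | exists (n : nat) (a : K), y = a *: iter n T x].

Definition supercyclic (T : X -> X) :=
  exists x : X, dense (projective_orbit T x).

(* [S k] stands for the map $S_{n_k}$ from [D2] to [X]; it is a total function
   whose values outside [D2] are never used. *)
Definition supercyclic_criterion (T : X -> X) :=
  exists (n : nat -> nat) (D1 D2 : set X) (S : nat -> X -> X),
    [/\ {homo n : i j / (i < j)%N},
        dense D1,
        dense D2,
        forall x y, D1 x -> D2 y ->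
          nanorm (iter (n k) T x) * nanorm (S k y) @[k --> \oo] --> (0 : R)
      & forall y, D2 y -> iter (n k) T (S k y) @[k --> \oo] --> y].

End Supercyclicity.

(* Main.v *)
Require Import Defs.
From mathcomp Require Import all_boot all_order all_algebra.
From mathcomp Require Import all_classical all_reals all_analysis.
From mathcomp Require Import lra.

(** The projective orbit of [x] is the set of values at [x] of the family of
    continuous maps [x |-> a *: T^n x]. By Baire's theorem, a
    family of continuous self-maps of a separable complete space has a dense
    orbit as soon as it is topologically transitive, that is, some map of the
    family sends a point of any given nonempty open [U] into any given nonempty
    open [V] ([universality_criterion]): the points whose orbit meets a given
    ball form a dense open set, and countably many balls suffice.

    The Supercyclic Criterion gives transitivity
    ([supercyclic_criterion_transitive]). Take [x] in [U] and [D1], [y] in [V]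
    and [D2], and perturb [x] to [x + a *: S_k y]. Its image under
    [a^-1 *: T^(n_k)] is [a^-1 *: T^(n_k) x + T^(n_k) (S_k y)], whose second
    term tends to [y]. Both errors, [|a| |S_k y|] and [|a|^-1 |T^(n_k) x|],
    must be small. Over the real numbers one would choose [a] to make them
    equal; here the values [|a|] may form a discrete set, but nontriviality
    provides [c] with [0 < |c| < 1], and the powers of [c] hit every positive
    real up to the fixed factor [|c|] ([naval_scale]). As the product of the
    two norms tends to 0, this bounded loss is harmless ([naval_balance]). *)

Set Implicit Arguments.
Unset Strict Implicit.
Unset Printing Implicit Defensive.

Import Order.TTheory GRing.Theory Num.Theory.
Import numFieldNormedType.Exports.
Local Open Scope classical_set_scope.
Local Open Scope ring_scope.

(** * Baire's theorem and dense orbits of families of maps *)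

Section CompletePseudoMetric.
Context (R : realType) (X : pseudoMetricType R).

(** The inductive step of Baire's theorem. Halving the radius of the outer ball
    leaves room for the limit of the centers: even if all later centers lie in
    [ball x (r / 2)], the limit may leave this ball, but it stays in
    [ball x r]. This replaces the use of closed balls. *)
Lemma dense_open_shrink (F : set X) (x : X) (r e : R) :
  open F -> dense F -> 0 < r -> 0 < e ->
  exists x' : X, exists r' : R,
    [/\ 0 < r', r' < e & ball x' r' `<=` ball x (r / 2) `&` F].
Proof.
move=> oF dF r0 e0.
have r20 : 0 < r / 2 by rewrite divr_gt0.
have oB : open (interior (ball x (r / 2))) by exact: open_interior.
have nB : interior (ball x (r / 2)) !=set0.
  by exists x; apply: nbhsx_ballx.
have [x' [Bx' Fx']] := dF _ nB oB.
have /nbhs_ballP[d /= d0 dBF] : nbhs x' (ball x (r / 2) `&` F).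
  by apply: filterI => //; exact: open_nbhs_nbhs.
exists x', (Num.min d (e / 2)); split.
- by rewrite lt_min d0 divr_gt0.
- by rewrite gt_min; apply/orP; right; lra.
- apply: subset_trans dBF; apply: le_ball; by rewrite ge_min lexx.
Qed.

(** The centers [x n] of balls nested by [dense_open_shrink], with radii below
    [1 / n], form a Cauchy sequence; its limit lies in every [ball (x n) (r n)],
    and [ball (x n.+1) (r n.+1)] is contained in [F n]. *)
Lemma baire (F : nat -> set X) : complete_space X ->
  (forall n, open (F n)) -> (forall n, dense (F n)) ->
  dense (\bigcap_n F n).
Proof.
move=> cX oF dF D [d Dd] oD.
have /nbhs_ballP[e /= e0 eD] : nbhs d D by exact: open_nbhs_nbhs.
have step (s : nat * (X * {posnum R})) : exists s' : X * {posnum R},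
    s'.2%:num < s.1.+1%:R^-1 /\
    ball s'.1 s'.2%:num `<=` ball s.2.1 (s.2.2%:num / 2) `&` F s.1.
  case: s => n [x r].
  have i0 : 0 < n.+1%:R^-1 :> R by rewrite invr_gt0.
  have [x' [r' [r'0 r'e r'F]]] :=
    dense_open_shrink x (oF n) (dF n) (gt0 r) i0.
  by exists (x', PosNum r'0).
have {step}[f fP] := choice step.
(* The initial ball is [ball d e], contained in [D]. *)
pose s := fix s n := if n is m.+1 then f (m, s m) else (d, PosNum e0).
pose x n := (s n).1; pose r n := (s n).2%:num.
have r0 n : 0 < r n by rewrite /r.
have rS n : r n.+1 < n.+1%:R^-1 by have [] := fP (n, s n).
have subF n : ball (x n.+1) (r n.+1) `<=` ball (x n) (r n / 2) `&` F n.
  by have [] := fP (n, s n).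
have half n : ball (x n) (r n / 2) `<=` ball (x n) (r n).
  by apply: le_ball; rewrite ler_pdivrMr // ler_peMr ?ler1n // ltW.
have nested n k : ball (x (k + n)%N) (r (k + n)%N) `<=` ball (x n) (r n).
  elim: k => [//|k IHk]; rewrite addSn.
  by move=> y /subF[/half/IHk].
have inhalf n m : (n < m)%N -> ball (x n) (r n / 2) (x m).
  move=> nm; have : ball (x n.+1) (r n.+1) (x m).
    by rewrite -(subnK nm); apply: nested; exact: ballxx.
  by move=> /subF[].
have cx : cauchy (x @ \oo).
  apply: cauchy_exP => _/posnumP[eps].
  have [N _ /(_ _ (leqnn N)) /= NP] := near_infty_natSinv_lt eps.
  exists (x N.+1); exists N.+2 => // m /= Nm.
  apply: (le_ball _ (half _ _ (inhalf _ _ Nm))).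
  by rewrite (le_trans (ltW (rS _))) ?ltW.
have [l xl] := cX (x @ \oo) _ cx.
have lin n : ball (x n) (r n) l.
  have r20 : 0 < r n / 2 by rewrite divr_gt0.
  have [N _ NP] := cvg_ball xl r20.
  have lx : ball l (r n / 2) (x (maxn N n.+1)).
    by apply: NP; exact: leq_maxl.
  have -> : r n = r n / 2 + r n / 2 by lra.
  apply: ball_triangle (ball_sym lx).
  by apply: inhalf; exact: leq_maxr.
exists l; split; first exact/eD/(lin 0%N).
by move=> n _; have /subF[] := lin n.+1.
Qed.

Lemma separable_dense_seq (x0 : X) : separable_space X ->
  exists a : nat -> X, dense (range a).
Proof.
move=> [A [/pfcard_geP[-> d0|/unsquash f dA]]].
  have [||y []] := d0 setT => //; first by exists x0.
  exact: openT.
exists f; move=> O O0 oO; have [y [Oy Ay]] := dA O O0 oO.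
by exists y; split => //; have [n _ <-] := 'surj_f Ay; exists n.
Qed.

(** The points with a dense orbit form the intersection, over the balls with
    center in a dense sequence and radius [1 / (m + 1)], of the open sets of
    points whose orbit meets the ball; transitivity says that each of these
    open sets is dense. *)
Lemma universality_criterion (J : Type) (f : J -> X -> X) :
  complete_space X -> separable_space X -> (forall i, continuous (f i)) ->
  (forall U V, open U -> open V -> U !=set0 -> V !=set0 ->
    exists i x, U x /\ V (f i x)) ->
  dense [set x | dense (range (f^~ x))].
Proof.
move=> cX sX cf tr D [d Dd] oD.
have [a da] := separable_dense_seq d sX.
pose B (k m : nat) : set X := interior (ball (a k) m.+1%:R^-1).
have oB k m : open (B k m) by exact: open_interior.
have B0 k m : B k m !=set0.
  by exists (a k); apply: nbhsx_ballx; rewrite invr_gt0.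
(* The pairs (center, radius) are enumerated by their codes; the integers that
   code no pair contribute the whole space. *)
pose G (n : nat) : set X :=
  if unpickle n is Some km then \bigcup_i (f i @^-1` B km.1 km.2) else setT.
have oG n : open (G n).
  rewrite /G; case: unpickle => [[k m]|]; last exact: openT.
  by apply: bigcup_open => i _; apply: open_comp => //.
have dG n : dense (G n).
  move=> U U0 oU; rewrite /G; case: unpickle => [[k m]|]; last first.
    by rewrite setIT.
  have [i [x [Ux Bx]]] := tr U (B k m) oU (oB k m) U0 (B0 k m).
  by exists x; split => //; exists i.
have [x [Dx Gx]] := baire cX oG dG (ex_intro _ d Dd) oD.
exists x; split=> // O [y Oy] oO.
have /nbhs_ballP[e /= e0 eO] : nbhs y O by exact: open_nbhs_nbhs.
have e20 : 0 < e / 2 by rewrite divr_gt0.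
have [m _ /(_ _ (leqnn m)) /= me] := near_infty_natSinv_lt (PosNum e20).
have mi0 : 0 < m.+1%:R^-1 :> R by rewrite invr_gt0.
have [z [yz [k _ akz]]] : (interior (ball y m.+1%:R^-1) `&` range a) !=set0.
  by apply: da; [exists y; exact: nbhsx_ballx | exact: open_interior].
have := Gx (pickle (k, m)) I.
rewrite /G pickleK => -[i _] /interior_subset /=; rewrite akz => fx.
exists (f i x); split; last by exists i.
apply: eO; apply: (le_ball _ (ball_triangle (interior_subset yz) fx)).
by rewrite [leRHS]splitr lerD // ltW.
Qed.

End CompletePseudoMetric.

(** * Scaling in a nontrivially valued field *)

Section Valuation.
Context (R : realType) (K : naValuedFieldType R).

Lemma naval_gt0 (a : K) : (0 < naval a) = (a != 0).
Proof.
rewrite lt_def naval_ge0 andbT; congr (~~ _).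
by apply/eqP/eqP => /naval_eq0.
Qed.

Lemma navalX (a : K) n : naval (a ^+ n) = naval a ^+ n.
Proof.
by elim: n => [|n IHn]; rewrite ?expr0 ?naval1 // !exprS navalM IHn.
Qed.

Lemma navalV (a : K) : naval a^-1 = (naval a)^-1.
Proof.
have [->|a0] := eqVneq a 0.
  by rewrite invr0 (proj2 (naval_eq0 _) erefl) invr0.
apply: (@mulfI _ (naval a)); first by rewrite gt_eqF ?naval_gt0.
by rewrite -navalM !divff ?naval1 // gt_eqF ?naval_gt0.
Qed.

Lemma exists_naval_lt1 : nontrivial_valuation K ->
  exists2 c : K, 0 < naval c & naval c < 1.
Proof.
move=> [c [c0 c1]]; have nc0 : 0 < naval c by rewrite naval_gt0.
have [lt|gt|eq] := ltgtP (naval c) 1; last by rewrite eq eqxx in c1.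
- by exists c.
- by exists c^-1; rewrite navalV ?invr_gt0 // invf_lt1.
Qed.

Lemma expr_eventually_lt (r e : R) : 0 <= r -> r < 1 -> 0 < e ->
  exists n, r ^+ n < e.
Proof.
move=> r0 r1 e0; have r1' : `|r| < 1 by rewrite ger0_norm.
have [N _ /(_ _ (leqnn N))] := cvg_ball (cvg_expr r1') e0.
by rewrite /ball /= sub0r normrN ger0_norm ?exprn_ge0 //; exists N.
Qed.

(** Among the quotients [c ^+ n / c ^+ N], whose values decrease geometrically
    to 0 as [n] grows, take the last one whose value exceeds [s]; the next one
    is smaller by the factor [naval c]. The integer [N] only serves to start
    above [s]. *)
Lemma naval_scale (c : K) (s : R) : 0 < naval c -> naval c < 1 -> 0 < s ->
  exists a : K, s < naval a /\ naval a * naval c <= s.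
Proof.
set r := naval c => r0 r1 s0.
have [N sN] : exists N, s * r ^+ N < 1.
  have si0 : 0 < s^-1 by rewrite invr_gt0.
  have [N rN] := expr_eventually_lt (ltW r0) r1 si0.
  by exists N; rewrite -ltr_pdivlMl // mulr1.
have rN0 : 0 < r ^+ N by rewrite exprn_gt0.
have exn : exists n, r ^+ n.+1 <= s * r ^+ N.
  have [n rn] := expr_eventually_lt (ltW r0) r1 (mulr_gt0 s0 rN0).
  by exists n; rewrite (le_trans _ (ltW rn)) // exprS ler_piMl ?exprn_ge0 // ltW.
case: (ex_minnP exn) => n rn nmin.
have rn' : s * r ^+ N < r ^+ n.
  case: n => [|n] in rn nmin *; first by rewrite expr0.
  by rewrite ltNge; apply/negP => /nmin; rewrite ltnn.
exists (c ^+ n / c ^+ N); rewrite navalM navalV !navalX -/r; split.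
  by rewrite ltr_pdivlMr.
by rewrite mulrAC -exprSr ler_pdivrMr.
Qed.

(** It suffices that [naval a] lies strictly between [p / e] and [e / q]; the
    hypothesis on [p * q] makes the ratio of these bounds larger than
    [(naval c)^-1], so that [naval_scale] finds a value between them. *)
Lemma naval_balance (c : K) (p q e : R) : 0 < naval c -> naval c < 1 ->
  0 <= p -> 0 <= q -> 0 < e -> p * q < e * (e * naval c) ->
  exists a : K, [/\ a != 0, naval a * q < e & naval a^-1 * p < e].
Proof.
move=> c0 c1 p0 q0 e0 pq.
suff [a [a0 aq ap]] : exists a : K, [/\ a != 0, naval a * q < e & p < naval a * e].
  exists a; split=> //; rewrite navalV mulrC ltr_pdivrMr ?naval_gt0 //.
  by rewrite mulrC.
have [|{}p0|{}p0] := ltgtP p 0; first by rewrite ltNge p0.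
- have [a [pa ac]] := naval_scale c0 c1 (divr_gt0 p0 e0).
  have a0 : 0 < naval a by apply: lt_trans pa; rewrite divr_gt0.
  exists a; split; rewrite -?naval_gt0 //; last by rewrite -ltr_pdivrMr.
  rewrite ler_pdivlMr // in ac.
  have ec : 0 < e * naval c by rewrite mulr_gt0.
  rewrite -(ltr_pM2r ec); apply: le_lt_trans pq.
  have := ler_wpM2r q0 ac; lra.
(* Here [p = 0], so that only [naval a * q < e] constrains [a]; the summand 1
   keeps the denominator nonzero when [q = 0]. *)
- have s0 : 0 < e * naval c / (q + 1) by rewrite !mulr_gt0 ?invr_gt0; lra.
  have [a [sa ac]] := naval_scale c0 c1 s0.
  have a0 : 0 < naval a by exact: lt_trans sa.
  exists a; split; rewrite -?naval_gt0 ?p0 ?mulr_gt0 //.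
  rewrite ler_pdivlMr in ac; last by lra.
  rewrite mulrAC ler_pM2r // in ac.
  by apply: lt_le_trans ac; rewrite mulrDr mulr1 ltrDl.
Qed.

End Valuation.

(** * The Supercyclic Criterion *)

Section SupercyclicCriterion.
Context (R : realType) (K : naValuedFieldType R) (X : naNormedModType K).

Lemma ball_nanormE (x y : X) (e : R) : ball x e y = (nanorm (x - y) < e).
Proof. by rewrite ballEmdist. Qed.

Lemma scaler_continuous_na (a : K) : continuous (fun x : X => a *: x).
Proof.
move=> x A /nbhs_ballP[e /= e0 eA].
have a1 : 0 < naval a + 1 by rewrite ltr_wpDl // naval_ge0.
apply/nbhs_ballP; exists (e / (naval a + 1)) => /=; first by rewrite divr_gt0.
move=> y; rewrite ball_nanormE => xy; apply: eA.
rewrite ball_nanormE -scalerBr nanormZ.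
rewrite ltr_pdivlMr // in xy.
by apply: le_lt_trans xy; rewrite mulrDr mulr1 mulrC lerDl nanorm_ge0.
Qed.

Lemma continuous_iter (T : X -> X) n : continuous T -> continuous (iter n T).
Proof.
move=> cT; elim: n => [|n IHn] x; first exact: cvg_id.
by apply: continuous_comp; [exact: IHn|exact: cT].
Qed.

Lemma linear_iterD (T : {linear X -> X}) n (x y : X) :
  iter n T (x + y) = iter n T x + iter n T y.
Proof. by elim: n => //= n ->; rewrite linearD. Qed.

Lemma linear_iterZ (T : {linear X -> X}) n a (x : X) :
  iter n T (a *: x) = a *: iter n T x.
Proof. by elim: n => //= n ->; rewrite linearZ. Qed.

(** The point sought is [x + a *: S k y], sent by [a^-1 *: T^(n k)] close to
    [y], for [x] in [U] and [D1], [y] in [V] and [D2], a large [k], and [a]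
    given by [naval_balance]. *)
Lemma supercyclic_criterion_transitive (T : {linear X -> X}) (U V : set X) :
  nontrivial_valuation K -> supercyclic_criterion T ->
  open U -> open V -> U !=set0 -> V !=set0 ->
  exists (i : nat * K) (x : X), U x /\ V (i.2 *: iter i.1 T x).
Proof.
move=> ntK [n [D1 [D2 [S [_ dD1 dD2 TS0 TSid]]]]] oU oV U0 V0.
have [c c0 c1] := exists_naval_lt1 ntK.
have [x [Ux D1x]] := dD1 U U0 oU; have [y [Vy D2y]] := dD2 V V0 oV.
have /nbhs_ballP[eU /= eU0 subU] : nbhs x U by exact: open_nbhs_nbhs.
have /nbhs_ballP[eV /= eV0 subV] : nbhs y V by exact: open_nbhs_nbhs.
pose e := Num.min eU eV; have e0 : 0 < e by rewrite lt_min eU0.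
have b0 : 0 < e * (e * naval c) by rewrite !mulr_gt0.
have [k [small close]] : exists k,
    nanorm (iter (n k) T x) * nanorm (S k y) < e * (e * naval c) /\
    ball y eV (iter (n k) T (S k y)).
  have [k] : exists k, (ball (0 : R) (e * (e * naval c))
        (nanorm (iter (n k) T x) * nanorm (S k y)) /\
      ball y eV (iter (n k) T (S k y))).
    near \oo => k; exists k; split; near: k.
      by apply: cvg_ball; [exact: TS0|].
    by apply: cvg_ball; [exact: TSid|].
  rewrite {1}/ball /= sub0r normrN ger0_norm ?mulr_ge0 ?nanorm_ge0 //.
  by move=> H; exists k.
have [a [a0 aS aT]] :=
  naval_balance c0 c1 (nanorm_ge0 _) (nanorm_ge0 _) e0 small.
exists (n k, a^-1), (x + a *: S k y); split.
  apply: subU; rewrite ball_nanormE opprD addNKr nanormN nanormZ.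
  by apply: (lt_le_trans aS); rewrite ge_min lexx.
apply: subV; rewrite /= linear_iterD linear_iterZ scalerDr scalerA mulVf //.
rewrite scale1r ball_nanormE opprD addrCA.
apply: (le_lt_trans (nanormD _ _)); rewrite gt_max nanormN nanormZ.
rewrite ball_nanormE in close; rewrite close andbT.
by apply: (lt_le_trans aT); rewrite ge_min lexx orbT.
Unshelve. all: by end_near. Qed.

End SupercyclicCriterion.

Theorem theorem3p14 (R : realType) (K : naValuedFieldType R)
    (X : naNormedModType K) (T : {linear X -> X}) :
  nontrivial_valuation K -> complete_space X -> separable_space X ->
  continuous T -> supercyclic_criterion T -> supercyclic T.
Proof.
move=> ntK cX sX cT crit.
pose f (i : nat * K) (x : X) := i.2 *: iter i.1 T x.
have cf i : continuous (f i).
  move=> x; apply: continuous_comp; first exact: continuous_iter.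
  exact: scaler_continuous_na.
have [||x [_ dx]] := universality_criterion cX sX cf _ (_ : [set: X] !=set0) openT.
- by move=> U V oU oV U0 V0; exact: supercyclic_criterion_transitive.
- by exists 0.
exists x => O O0 oO; have [y [Oy [[n a] _ fy]]] := dx O O0 oO.
by exists y; split => //; exists n, a; rewrite -fy.
Qed.
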